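(* Fourier-invariant signals achieve isoresolution: if $f\in L^2(\mathbb{R})$ is a nonzero function whose Fourier transform $F$ satisfies $F(\omega) = \lambda f(\omega)$ for some scalar $\lambda\in\mathbb{C}$, then $\Delta_t = \Delta_\omega$.
   Context: The Fourier transform is $F(\omega) = \int_{-\infty}^{\infty} f(t) e^{-j\omega t}\,dt$ with $j^2=-1$, extended to $L^2(\mathbb{R})$ in the usual (Plancherel) way; equalities of $L^2$ functions hold almost everywhere. For a nonzero $f\in L^2(\mathbb{R})$ with energy $E=\int_{-\infty}^{\infty}|f(t)|^2\,dt$, the time and frequency moments are $\overline{t^n} = \frac1E\int_{-\infty}^\infty t^n|f(t)|^2\,dt$ and $\overline{\omega^n} = \frac{1}{2\pi E}\int_{-\infty}^\infty \omega^n|F(\omega)|^2\,d\omega$. The time resolution and frequency resolution are the standard deviations $\Delta_t = \sqrt{\overline{(t-\overline t)^2}}$ and $\Delta_\omega = \sqrt{\overline{(\omega-\overline\omega)^2}}$, where the overline denotes averaging against the densities $|f(t)|^2/E$ and $|F(\omega)|^2/(2\pi E)$ respectively. If the second moment $\overline{t^2}$ (resp. $\overline{\omega^2}$) is infinite, one sets $\Delta_t=\infty$ (resp. $\Delta_\omega=\infty$). *)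

(* Defs.v *)
From HB Require Import structures.
From mathcomp Require Import all_boot all_order all_algebra.
From mathcomp Require Import all_classical all_reals all_analysis.
From mathcomp.real_closed Require Import complex.

Set Implicit Arguments.
Unset Strict Implicit.
Unset Printing Implicit Defensive.
Import Order.TTheory GRing.Theory Num.Theory.
Import numFieldNormedType.Exports.
Local Open Scope classical_set_scope.
Local Open Scope ring_scope.

Section FourierInvariant.
Variable R : realType.
Local Notation mu := (@lebesgue_measure R).
Implicit Types (f g F : R -> R[i]) (p : R -> R).

Definition cmeasurable f :=
  measurable_fun setT (fun t => complex.Re (f t)) /\
  measurable_fun setT (fun t => complex.Im (f t)).

Definition in_L1 f :=
  cmeasurable f /\ (\int[mu]_t (Normc.normc (f t))%:E < +oo)%E.

Definition in_L2 f :=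
  cmeasurable f /\ (\int[mu]_t (Normc.normc (f t) ^+ 2)%:E < +oo)%E.

Definition cexpi (x : R) : R[i] := Complex (cos x) (sin x).

Definition cintegral f : R[i] :=
  Complex (\int[mu]_t complex.Re (f t)) (\int[mu]_t complex.Im (f t)).

Definition fourier_integral f (w : R) : R[i] :=
  cintegral (fun t => f t * cexpi (- (w * t))).

Definition cvg_L2 (f_ : nat -> R -> R[i]) f :=
  (\int[mu]_t (Normc.normc (f_ n t - f t) ^+ 2)%:E)%E @[n --> \oo] --> 0%E.

(* The Fourier transform on L^2 as the extension by continuity of
   [fourier_integral] from L^1 `&` L^2. It is a relation because the transform
   is only determined up to equality almost everywhere: [F] ranges over all
   representatives of the transform of [f]. *)
Definition is_fourier_transform f F :=
  [/\ in_L2 f, in_L2 F &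
      exists f_ : nat -> R -> R[i],
        [/\ forall n, in_L1 (f_ n) /\ in_L2 (f_ n),
            cvg_L2 f_ f &
            cvg_L2 (fun n => fourier_integral (f_ n)) F]].

Definition energy f : R := \int[mu]_t (Normc.normc (f t) ^+ 2).

Definition time_density f (t : R) : R := Normc.normc (f t) ^+ 2 / energy f.

Definition freq_density f F (w : R) : R :=
  Normc.normc (F w) ^+ 2 / (2 * pi * energy f).

Definition second_moment p : \bar R := \int[mu]_x (x ^+ 2 * p x)%:E.

Definition mean p : R := \int[mu]_x (x * p x).

Definition std_dev p : \bar R :=
  if second_moment p == +oo%E then +oo%E
  else (Num.sqrt (\int[mu]_x ((x - mean p) ^+ 2 * p x)))%:E.

Definition time_resolution f : \bar R := std_dev (time_density f).

(* [F] is meant to be the Fourier transform of [f]; the normalization uses the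
   energy of [f]. *)
Definition freq_resolution f F : \bar R := std_dev (freq_density f F).

End FourierInvariant.

(* Main.v *)
Require Import Defs.
From HB Require Import structures.
From mathcomp Require Import all_boot all_order all_algebra.
From mathcomp Require Import all_classical all_reals all_analysis.
From mathcomp.real_closed Require Import complex.
From mathcomp Require Import measurable_realfun ring lra.
Import Order.TTheory GRing.Theory Num.Theory.
Import numFieldNormedType.Exports.
Local Open Scope classical_set_scope.
Local Open Scope ring_scope.

(** The point is that [|lambda|^2 = 2 pi]; the two densities then agree almost
    everywhere.  Transposing the transform onto a Gaussian [g_m] centred at [m]
    (Fubini on L^1, then L^2 limits) and doing it twice gives
    [lambda^2 <f, g_m> = 2 pi <f, g_(-m)>], since the Gaussian transforms are
    explicit.  Hence [lambda^4 <f, g_m> = (2 pi)^2 <f, g_m>], and it remains to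
    find a Gaussian with [<f, g_m> != 0].  If there were none, multiplying [f]
    by a fixed Gaussian would give an integrable [h] orthogonal to all powers of
    [y = exp (- k (t - a)^2)]; as [1 - (1 - y^p)^(2^p)] tends boundedly to the
    indicator of [y > 1/2], which is a ball, all ball integrals of [h] would
    vanish, and [f = 0] by Lebesgue differentiation. *)

(** Plancherel's identity would give the modulus of lambda at once from the norms of [F] and [f];
    here it is read off a single nonzero pairing instead, which takes only explicit Gaussian
    integrals, Fubini and limits. The reflection of [m] to [- m] is what remains of the inversion
    formula: transforming twice yields 2 pi times the reflected function, and the fourth power of
    lambda undoes the reflection. Off-centre Gaussians matter because centred ones are even and pair
    to zero with every odd [f]. All test functions are real, so the transform of [g_m] enters
    through its cosine and sine parts, and the complex identities are proved as pairs of real ones.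
    The polynomials in [y] come from elementary proofs of the Stone-Weierstrass theorem; as [h] is
    merely integrable, what counts is bounded pointwise convergence rather than uniform
    approximation. *)

(** * Integrals of real functions over the line *)

Section real_integrals.
Context {R : realType}.
Local Notation mu := (@lebesgue_measure R).
Implicit Types f g h p u v : R -> R.

Lemma integrable_measurable f :
  mu.-integrable setT (EFin \o f) -> measurable_fun setT f.
Proof. by move=> /integrableP[/measurable_EFinP]. Qed.

Lemma le_integrable_real f g : measurable_fun setT f ->
  (forall x, `|f x| <= g x) -> mu.-integrable setT (EFin \o g) ->
  mu.-integrable setT (EFin \o f).
Proof.
move=> mf fg; apply: le_integrable => //; first exact/measurable_EFinP.
by move=> x _ /=; rewrite lee_fin (le_trans (fg x))// ler_norm.
Qed.

Lemma integrable_mul_bounded f g (M : R) : measurable_fun setT f ->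
  (forall x, `|f x| <= M) -> mu.-integrable setT (EFin \o g) ->
  mu.-integrable setT (EFin \o (fun x => f x * g x)).
Proof.
move=> mf fM ig.
apply: (@le_integrable_real _ (fun x => M * `|g x|)).
- by apply: measurable_funM => //; exact: integrable_measurable.
- by move=> x; rewrite normrM ler_wpM2r.
- exact: (integrableZl measurableT M (integrable_norm ig)).
Qed.

Lemma integrable_cos_mul (k l : R) g : mu.-integrable setT (EFin \o g) ->
  mu.-integrable setT (EFin \o (fun x => cos (k * x + l) * g x)).
Proof.
apply: (@integrable_mul_bounded _ _ 1); last first.
  by move=> x; rewrite ler_norml cos_geN1 cos_le1.
apply: measurableT_comp.
  by apply: continuous_measurable_fun; exact: continuous_cos.
by apply: measurable_funD => //; exact: measurable_funM.
Qed.

(** The fundamental theorem of calculus on growing intervals, combined with dominated convergence.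
    With a product for [F], this is integration by parts over the whole line. *)
Lemma Rintegral_derive_eq0 (F f : R -> R) :
  (forall x : R, is_derive x (1 : R) F (f x)) -> continuous f ->
  mu.-integrable setT (EFin \o f) ->
  F n%:R @[n --> \oo] --> (0 : R) -> F (- n%:R) @[n --> \oo] --> (0 : R) ->
  \int[mu]_x f x = 0.
Proof.
move=> dF cf intf F0 F0N.
(* [n.+1] keeps the interval nondegenerate at [n = 0], as the fundamental theorem of calculus
   asks. *)
pose J (n : nat) : set R := [set` `[- n.+1%:R, n.+1%:R]].
have FTC n : (\int[mu]_(x in J n) (f x)%:E)%E =
    (F n.+1%:R - F (- n.+1%:R))%:E.
  have cF : continuous F.
    by move=> x; apply/differentiable_continuous/derivable1_diffP; case: (dF x).
  rewrite (@continuous_FTC2 _ f F) ?EFinB//.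
  - by rewrite gtrN.
  - exact: continuous_subspaceT.
  - split; first by move=> x _; case: (dF x).
    + by apply: cvg_at_right_filter; exact: cF.
    + by apply: cvg_at_left_filter; exact: cF.
  - by move=> x _; rewrite derive1E; exact: derive_val.
have cvg1 : (F n.+1%:R - F (- n.+1%:R))%:E @[n --> \oo] -->
    (\int[mu]_x f x)%:E.
  rewrite fineK; last exact: integrable_fin_num.
  under eq_cvg do rewrite -FTC integral_mkcond.
  apply: (@dominated_cvg _ _ _ mu _ _ _ _ (abse \o (EFin \o f))) => //.
  - move=> n; apply/(measurable_restrictT _ _).1; first exact: measurable_itv.
    by apply: measurable_funTS; exact: measurable_int intf.
  - move=> x _; apply: cvg_near_cst.
    exists (Num.trunc `|x|) => // n /= xn.
    have xJ : x \in J n.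
      rewrite inE /J/= in_itv/= -ler_norml ltW//.
      by rewrite (lt_le_trans (truncnS_gt _))// ler_nat ltnS.
    by rewrite patchE xJ.
  - exact: integrable_abse.
  - move=> n x _; rewrite patchE; case: ifPn => //= _.
    by rewrite normr0 lee_fin.
have cvg2 : F n.+1%:R - F (- n.+1%:R) @[n --> \oo] --> (0 : R) - 0.
  by apply: cvgB; [move: F0|move: F0N];
    rewrite -(cvg_shiftS (fun n => F _)).
rewrite subr0 in cvg2.
exact: (cvg_unique _ (fine_cvg cvg1) cvg2).
Qed.

End real_integrals.

(** * Gaussian integrals and the transform of a translated Gaussian *)

Section gaussian.
Context {R : realType}.
Local Notation mu := (@lebesgue_measure R).
Implicit Types m s w x k l : R.

Lemma normal_funE m s x : s != 0 ->
  normal_fun m s x = (normal_peak s)^-1 * normal_pdf m s x.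
Proof.
by move=> s0; rewrite normal_pdfE// mulKf// gt_eqF// normal_peak_gt0.
Qed.

Lemma integrable_normal_fun m s : s != 0 ->
  mu.-integrable setT (EFin \o normal_fun m s).
Proof.
move=> s0; have := integrableZl measurableT (normal_peak s)^-1
  (integrable_normal_pdf m s).
by apply: eq_integrable => // x _ /=; rewrite normal_funE.
Qed.

Lemma Rintegral_normal_fun m s : s != 0 ->
  \int[mu]_x normal_fun m s x = (normal_peak s)^-1.
Proof.
move=> s0; under eq_Rintegral do rewrite normal_funE//.
rewrite RintegralZl//; last exact: integrable_normal_pdf.
by rewrite /Rintegral integral_normal_pdf mulr1.
Qed.

Lemma normal_fun_gt0 m s x : 0 < normal_fun m s x.
Proof. exact: expR_gt0. Qed.

Lemma normal_fun_le1 m s x : normal_fun m s x <= 1.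
Proof.
rewrite -expR0 ler_expR mulNr oppr_le0 divr_ge0// ?sqr_ge0//.
by rewrite mulrn_wge0// sqr_ge0.
Qed.

Lemma cvg_normal_fun m s : s != 0 ->
  normal_fun m s n%:R @[n --> \oo] --> (0 : R).
Proof.
move=> s0; pose c := Num.sqrt (s ^+ 2 *+ 2).
have c0 : 0 < c by rewrite sqrtr_gt0 pmulrn_lgt0// exprn_even_gt0.
have E x : normal_fun m s x = gauss_fun ((x - m) * c^-1).
  congr expR; rewrite mulNr exprMn exprVn; congr (- (_ * _^-1)).
  by rewrite sqr_sqrtr// pmulrn_lge0// sqr_ge0.
under eq_cvg do rewrite E.
apply: (cvg_comp (fun n : nat => (n%:R - m) * c^-1) gauss_fun); last first.
  exact: cvg_gauss_fun.
apply: (cvg_comp (fun n : nat => n%:R : R) (fun x : R => (x - m) * c^-1)).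
  exact: cvgr_idn.
by apply: gt0_cvgMly; [rewrite invr_gt0|exact: cvg_addrr].
Qed.

Lemma normal_funN m s x : normal_fun m s (- x) = normal_fun (- m) s x.
Proof. by rewrite /normal_fun -opprD sqrrN opprK. Qed.

Lemma cvg_normal_funN m s : s != 0 ->
  normal_fun m s (- n%:R) @[n --> \oo] --> (0 : R).
Proof.
by move=> s0; under eq_cvg do rewrite normal_funN; exact: cvg_normal_fun.
Qed.

Lemma is_derive_normal_fun m s x : s != 0 ->
  is_derive x (1 : R) (normal_fun m s) (- (x - m) / s ^+ 2 * normal_fun m s x).
Proof.
by move=> s0; apply: is_derive_eq; rewrite /GRing.scale/= /normal_fun; field.
Qed.

(** Half of the exponent absorbs the linear factor. Widening [s] to [s * sqrt 2] halves the
    exponent, which leaves a spare [expR (- y)]; it beats [x - m] because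
    [|x - m| <= 1 + (x - m) ^+ 2], where the square is a multiple of [y], and [1 + y <= expR y]. *)
Lemma integrable_center_normal_fun m s : s != 0 ->
  mu.-integrable setT (EFin \o (fun x => (x - m) * normal_fun m s x)).
Proof.
move=> s0; pose s2 := s * Num.sqrt 2.
have s20 : s2 != 0 by rewrite mulf_neq0// sqrtr_eq0 -ltNge.
have s2E : s2 ^+ 2 = s ^+ 2 *+ 2 by rewrite exprMn sqr_sqrtr// mulr_natr.
apply: (@le_integrable_real _ _ (fun x => (1 + s2 ^+ 2 *+ 2) * normal_fun m s2 x)).
- apply: measurable_funM; last exact: measurable_normal_fun.
  exact: measurable_funB.
- move=> x; rewrite normrM (gtr0_norm (normal_fun_gt0 _ _ _)).
  pose y := (x - m) ^+ 2 / (s2 ^+ 2 *+ 2).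
  have -> : normal_fun m s x = expR (- y) * normal_fun m s2 x.
    rewrite /normal_fun -expRD /y s2E; congr expR.
    by field.
  rewrite mulrA ler_wpM2r ?normal_fun_ge0//.
  rewrite expRN ler_pdivrMr ?expR_gt0//.
  have y1 := expR_ge1Dx y.
  have yE : (x - m) ^+ 2 = y * (s2 ^+ 2 *+ 2).
    by rewrite divfK// mulrn_eq0/= expf_neq0.
  have a0 : 0 <= s2 ^+ 2 *+ 2 by rewrite mulrn_wge0 ?sqr_ge0.
  have y0 : 0 <= y by rewrite divr_ge0 ?sqr_ge0.
  have h : `|x - m| <= 1 + (x - m) ^+ 2.
    rewrite -(real_normK (num_real (x - m))).
    by have := normr_ge0 (x - m); nra.
  rewrite (le_trans h)// yE.
  rewrite (@le_trans _ _ ((1 + s2 ^+ 2 *+ 2) * (1 + y)))//; first nra.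
  by rewrite ler_wpM2l// addr_ge0.
- exact: (integrableZl measurableT _ (integrable_normal_fun _ _ s20)).
Qed.

Lemma continuous_normal_fun m s : s != 0 -> continuous (normal_fun m s).
Proof.
move=> s0 x; apply/differentiable_continuous/derivable1_diffP.
by case: (is_derive_normal_fun m s x s0).
Qed.

Lemma continuous_sin_affine k l : continuous (fun x : R => sin (k * x + l)).
Proof.
move=> x; apply: (@continuous_comp _ _ _ (fun x : R => k * x + l) sin).
  by apply: cvgD; [apply: cvgMr; exact: cvg_id|exact: cvg_cst].
exact: continuous_sin.
Qed.

Lemma continuous_cos_affine k l : continuous (fun x : R => cos (k * x + l)).
Proof.
move=> x; apply: (@continuous_comp _ _ _ (fun x : R => k * x + l) cos).
  by apply: cvgD; [apply: cvgMr; exact: cvg_id|exact: cvg_cst].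
exact: continuous_cos.
Qed.

(** Integration by parts: the derivative of [normal_fun m s x * sin (w * x + l)] is the difference
    of the two integrands up to constants, and the boundary terms vanish because the sine is bounded
    and the Gaussian decays. *)
Lemma Rintegral_center_sin_normal_fun m s w l : s != 0 ->
  \int[mu]_x (sin (w * x + l) * ((x - m) * normal_fun m s x)) =
  s ^+ 2 * w * \int[mu]_x (cos (w * x + l) * normal_fun m s x).
Proof.
move=> s0.
pose F x := normal_fun m s x * sin (w * x + l).
pose c x := cos (w * x + l) * normal_fun m s x.
pose d x := sin (w * x + l) * ((x - m) * normal_fun m s x).
pose f x := w * c x - s ^- 2 * d x.
have intc : mu.-integrable setT (EFin \o c).
  exact/integrable_cos_mul/integrable_normal_fun.
have intd : mu.-integrable setT (EFin \o d).
  apply: (@integrable_mul_bounded _ _ _ 1).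
  - by apply: continuous_measurable_fun; exact: continuous_sin_affine.
  - by move=> x; rewrite ler_norml sin_geN1 sin_le1.
  - exact: integrable_center_normal_fun.
have intwc : mu.-integrable setT (EFin \o (fun x => w * c x)).
  exact: (integrableZl measurableT w intc).
have intsd : mu.-integrable setT (EFin \o (fun x => s ^- 2 * d x)).
  exact: (integrableZl measurableT (s ^- 2) intd).
have : \int[mu]_x f x = 0.
  apply: (@Rintegral_derive_eq0 _ F).
  - move=> x; have dN := is_derive_normal_fun m s x s0.
    apply: is_derive_eq; rewrite /GRing.scale/= /f /c /d.
    by field.
  - move=> x; apply: cvgB; apply: cvgMr.
      by apply: cvgM; [exact: continuous_cos_affine|exact: continuous_normal_fun].
    apply: cvgM; first exact: continuous_sin_affine.
    apply: cvgM; last exact: continuous_normal_fun.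
    by apply: cvgB; [exact: cvg_id|exact: cvg_cst].
  - exact: (integrableB measurableT intwc intsd).
  - apply/norm_cvg0P.
    apply: (@squeeze_cvgr _ _ _ _ (cst 0) (fun n => normal_fun m s n%:R)).
    + apply: nearW => n; rewrite normr_ge0/= normrM gtr0_norm ?normal_fun_gt0//.
      by rewrite ler_piMr ?normal_fun_ge0// ler_norml sin_geN1 sin_le1.
    + exact: cvg_cst.
    + exact: cvg_normal_fun.
  - apply/norm_cvg0P.
    apply: (@squeeze_cvgr _ _ _ _ (cst 0) (fun n => normal_fun m s (- n%:R))).
    + apply: nearW => n; rewrite normr_ge0/= normrM gtr0_norm ?normal_fun_gt0//.
      by rewrite ler_piMr ?normal_fun_ge0// ler_norml sin_geN1 sin_le1.
    + exact: cvg_cst.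
    + exact: cvg_normal_funN.
rewrite RintegralB// RintegralZl// RintegralZl// => /eqP; rewrite subr_eq0 => /eqP E.
by rewrite -mulrA E mulrA mulfV ?mul1r// expf_neq0.
Qed.

(** Centring the frequency factor at [m] makes differentiation in [w] bring down [x - m], the very
    factor in the derivative of the Gaussian. Integration by parts then closes the equation
    [A' = - s^2 w A]. The free phase [l] lets one computation serve both cosine and sine. *)
Lemma is_derive_Rintegral_cos_normal_fun m s l w : s != 0 ->
  is_derive w (1 : R)
    (fun w => \int[mu]_x (cos (w * (x - m) + l) * normal_fun m s x))
    (- (s ^+ 2 * w * \int[mu]_x (cos (w * (x - m) + l) * normal_fun m s x))).
Proof.
move=> s0.
pose f w x := cos (w * (x - m) + l) * normal_fun m s x.
have df v x : is_derive v (1 : R) (f ^~ x)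
    (- sin (v * (x - m) + l) * ((x - m) * normal_fun m s x)).
  by apply: is_derive_eq; rewrite /GRing.scale/= /f; ring.
have wI : [set` `]w - 1, w + 1[] w by rewrite /= in_itv/= gtrBl ltrDl ltr01.
have intf v : mu.-integrable setT (EFin \o f v).
  have := integrable_cos_mul v (l - v * m) _ (integrable_normal_fun m s s0).
  by apply: eq_integrable => // x _ /=; rewrite /f mulrBr addrAC addrA.
have derf v x : derivable (f ^~ x) v 1 by case: (df v x).
have d1f v x : partial1of2 f v x =
    - sin (v * (x - m) + l) * ((x - m) * normal_fun m s x).
  by rewrite partial1of2E; exact: derive_val.
(* A dominating function independent of the frequency, as differentiation under the integral
   requires. *)
pose G x := `|(x - m) * normal_fun m s x|.
have intG : mu.-integrable setT (EFin \o G).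
  exact/integrable_norm/integrable_center_normal_fun.
have Gub v x : `|partial1of2 f v x| <= G x.
  rewrite d1f normrM normrN ler_piMl// ler_norml sin_geN1 sin_le1//.
have dI := @derivable_under_integral _ _ _ mu f _ measurableT _ _ _ wI
  (fun v _ => intf v) (fun v x _ _ => derf v x) G (fun=> normr_ge0 _) intG
  (fun v x _ _ => Gub v x).
have eI := @differentiation_under_integral _ _ _ mu f _ measurableT _ _ _ wI
  (fun v _ => intf v) (fun v x _ _ => derf v x) G (fun=> normr_ge0 _) intG
  (fun v x _ _ => Gub v x).
apply: DeriveDef; first exact: dI.
rewrite -derive1E eI.
under eq_Rintegral do rewrite d1f mulNr.
have E x : w * (x - m) + l = w * x + (l - w * m) by ring.
under eq_Rintegral do rewrite E.
under [in RHS]eq_Rintegral do rewrite E.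
rewrite -Rintegral_center_sin_normal_fun// -[RHS]mulN1r -RintegralZl//.
  by under [in RHS]eq_Rintegral do rewrite mulN1r.
apply: (@integrable_mul_bounded _ _ _ 1).
- by apply: continuous_measurable_fun; exact: continuous_sin_affine.
- by move=> x; rewrite ler_norml sin_geN1 sin_le1.
- exact: integrable_center_normal_fun.
Qed.

(** Solving the differential equation: multiplied by the integrating factor
    [expR (s ^+ 2 * w ^+ 2 / 2)], the integral is constant in [w], and at [w = 0] it is [cos l]
    times the mass of the Gaussian. *)
Lemma Rintegral_cos_center_normal_fun m s l w : s != 0 ->
  \int[mu]_x (cos (w * (x - m) + l) * normal_fun m s x) =
  cos l * (normal_peak s)^-1 * expR (- (s ^+ 2 * w ^+ 2 / 2)).
Proof.
move=> s0.
pose A w := \int[mu]_x (cos (w * (x - m) + l) * normal_fun m s x).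
pose B w := A w * expR (s ^+ 2 * w ^+ 2 / 2).
have dB (v : R) : is_derive v (1 : R) B 0.
  have dA : is_derive v (1 : R) A (- (s ^+ 2 * v * A v)).
    exact: is_derive_Rintegral_cos_normal_fun.
  by apply: is_derive_eq; rewrite /GRing.scale/=; field.
have B0 : B w = cos l * (normal_peak s)^-1.
  rewrite (is_derive_0_is_cst w 0 dB) /B expr0n/= mulr0 mul0r expR0 mulr1 /A.
  under eq_Rintegral do rewrite mul0r add0r.
  by rewrite RintegralZl ?Rintegral_normal_fun//; exact: integrable_normal_fun.
by rewrite -B0 /B -(mulrA (A w)) -expRD subrr expR0 mulr1.
Qed.

Lemma Rintegral_cos_normal_fun m s w : s != 0 ->
  \int[mu]_x (cos (w * x) * normal_fun m s x) =
  cos (w * m) * (normal_peak s)^-1 * expR (- (s ^+ 2 * w ^+ 2 / 2)).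
Proof.
move=> s0; rewrite -(Rintegral_cos_center_normal_fun m)//.
by apply: eq_Rintegral => x _; rewrite mulrBr subrK.
Qed.

(** The phase is [w * m], as for the cosine, shifted by a quarter turn: [w * m - pi / 2]. *)
Lemma Rintegral_sin_normal_fun m s w : s != 0 ->
  \int[mu]_x (sin (w * x) * normal_fun m s x) =
  sin (w * m) * (normal_peak s)^-1 * expR (- (s ^+ 2 * w ^+ 2 / 2)).
Proof.
move=> s0; rewrite -cosBpihalf -(Rintegral_cos_center_normal_fun m)//.
by apply: eq_Rintegral => x _; rewrite mulrBr addrA subrK cosBpihalf.
Qed.

End gaussian.

(** * Multiplication formula on L^1 for a bounded continuous kernel *)

Section multiplication_formula.
Context {R : realType}.
Local Notation mu := (@lebesgue_measure R).
Variables (u k : R -> R).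
Hypothesis intu : mu.-integrable setT (EFin \o u).
Hypotheses (ck : continuous k) (k1 : forall x, `|k x| <= 1).

Let measurable_k (w : R) : measurable_fun setT (fun t : R => k (w * t)).
Proof.
apply: measurableT_comp; first exact: continuous_measurable_fun.
exact: measurable_funM.
Qed.

Lemma integrable_kernel (w : R) :
  mu.-integrable setT (EFin \o (fun t : R => u t * k (w * t))).
Proof.
have := @integrable_mul_bounded _ _ u 1 (measurable_k w) (fun t => k1 (w * t)) intu.
by apply: eq_integrable => // t _ /=; rewrite mulrC.
Qed.

(** The integrand is dominated by [|u|] at every frequency. Continuity is what later provides the
    measurability of Fourier integrals. *)
Lemma continuous_Rintegral_kernel :
  continuous (fun w : R => \int[mu]_t (u t * k (w * t))).
Proof.
move=> w.
have wI : w \in ([set` `]w - 1, w + 1[] : set R).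
  by rewrite inE /= in_itv/= gtrBl ltrDl ltr01.
apply: (@continuity_under_integral _ _ _ mu (fun w t : R => u t * k (w * t)) setT
  measurableT (w - 1) (w + 1) _ _ (fun t => `|u t|) _ _ w wI).
- by move=> v _; exact: integrable_kernel.
- apply: aeW => t _ v _; apply: cvgMr.
  apply: (@continuous_comp _ _ _ (fun v : R => v * t) k); last exact: ck.
  by apply: cvgMl; exact: cvg_id.
- exact: integrable_norm.
- by move=> v _; apply: aeW => t _; rewrite normrM ler_piMr.
Qed.

(** Fubini applies since the kernel is bounded by 1: the double integrand is at most [|p w| |u t|],
    whose iterated integral is a product of two finite ones. *)
Lemma Rintegral_kernel_swap (p : R -> R) : mu.-integrable setT (EFin \o p) ->
  \int[mu]_w (p w * \int[mu]_t (u t * k (w * t))) =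
  \int[mu]_t (u t * \int[mu]_w (p w * k (w * t))).
Proof.
move=> intp.
pose phi (z : measurableTypeR R * measurableTypeR R) : \bar R :=
  (p z.1 * (u z.2 * k (z.1 * z.2)))%:E.
have mu_ := @integrable_measurable _ _ intu.
have mp := @integrable_measurable _ _ intp.
have mphi : measurable_fun setT phi.
  apply/measurable_EFinP; apply: measurable_funM.
    exact: (measurableT_comp mp).
  apply: measurable_funM; first exact: (measurableT_comp mu_).
  apply: measurableT_comp; first exact: continuous_measurable_fun.
  exact: measurable_funM.
have intpk t : mu.-integrable setT (EFin \o (fun w => p w * k (w * t))).
  apply: (@le_integrable_real _ _ (fun w => `|p w|)).
  - apply: measurable_funM => //.
    apply: measurableT_comp; first exact: continuous_measurable_fun.
    exact: measurable_funM.
  - by move=> w; rewrite normrM ler_piMr.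
  - exact: integrable_norm.
have iphi : (mu \x mu)%E.-integrable setT phi.
  apply/integrable12ltyP => //.
  apply: (@le_lt_trans _ _ (\int[mu]_w (`|p w|%:E * \int[mu]_t `|u t|%:E))%E).
    apply: ge0_le_integral => //.
    - by move=> w _; exact: integral_ge0.
    - apply: (measurable_fun_fubini_tonelli_F (abse \o phi)) => //=.
      exact: measurableT_comp.
    - apply: emeasurable_funM => //.
      by apply/measurable_EFinP; exact: measurableT_comp.
    - move=> w _; rewrite -ge0_integralZl//; last first.
        by apply/measurable_EFinP; exact: measurableT_comp.
      apply: ge0_le_integral => //.
      + by apply/measurableT_comp => //; exact: measurableT_comp.
      + by apply: measurable_funeM; apply/measurable_EFinP; exact: measurableT_comp.
      + move=> t _; rewrite /phi/= -EFinM lee_fin !normrM ler_wpM2l//.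
        by rewrite ler_piMr.
  have U : (\int[mu]_t `|u t|%:E)%E \is a fin_num.
    exact/integrable_fin_num/integrable_norm.
  rewrite -(fineK U) ge0_integralZr//; last 2 first.
  - by apply/measurable_EFinP; exact: measurableT_comp.
  - by rewrite lee_fin fine_ge0// integral_ge0.
  rewrite -(fineK (integrable_fin_num measurableT (integrable_norm intp))).
  by rewrite -EFinM ltry.
rewrite /Rintegral; congr fine.
transitivity (\int[mu]_w \int[mu]_t phi (w, t))%E.
  apply: eq_integral => w _; rewrite EFinM fineK; last first.
    exact: integrable_fin_num (integrable_kernel w).
  by rewrite -integralZl//; exact: integrable_kernel.
rewrite (Fubini iphi); apply: eq_integral => t _.
rewrite EFinM fineK; last exact: integrable_fin_num (intpk t).
rewrite -integralZl//; last exact: intpk.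
by apply: eq_integral => w _; rewrite /phi/= -EFinM; congr EFin; ring.
Qed.

End multiplication_formula.

(** * Square integrable functions and limits of pairings *)

Section square_integrable.
Context {R : realType}.
Local Notation mu := (@lebesgue_measure R).
Implicit Types u v p : R -> R.

Definition square_integrable u := measurable_fun setT u /\
  mu.-integrable setT (EFin \o (fun t => u t ^+ 2)).

Lemma integrable_mul_L2 u v : square_integrable u -> square_integrable v ->
  mu.-integrable setT (EFin \o (fun t => u t * v t)).
Proof.
move=> [mu_ iu] [mv iv].
apply: (@le_integrable_real _ _ (fun t => u t ^+ 2 + v t ^+ 2)).
- exact: measurable_funM.
- move=> t; rewrite normrM -(real_normK (num_real (u t))).
  rewrite -(real_normK (num_real (v t))).
  have := sqr_ge0 (`|u t| - `|v t|).
  have := normr_ge0 (u t); have := normr_ge0 (v t); nra.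
- exact: (integrableD measurableT iu iv).
Qed.

Lemma square_integrable_bounded p (M : R) : (forall t, `|p t| <= M) ->
  mu.-integrable setT (EFin \o p) -> square_integrable p.
Proof.
move=> pM ip; have mp := @integrable_measurable _ _ ip.
by split=> //; exact: (@integrable_mul_bounded _ _ _ M).
Qed.

(** A weighted AM-GM inequality plays the role of Cauchy-Schwarz. The sequence is only assumed
    measurable because it will also be a sequence of Fourier integrals, whose square integrability
    would be part of Plancherel's theorem. *)
Lemma cvg_Rintegral_mul_L2 (u_ : nat -> R -> R) u p :
  (forall n, measurable_fun setT (u_ n)) ->
  square_integrable u -> square_integrable p ->
  (\int[mu]_t ((u_ n t - u t) ^+ 2)%:E)%E @[n --> \oo] --> 0%E ->
  \int[mu]_t (u_ n t * p t) @[n --> \oo] --> \int[mu]_t (u t * p t).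
Proof.
move=> mu_ u2 p2 /fine_cvgP[fin0 cvg0].
pose P := \int[mu]_t (p t ^+ 2).
have P0 : 0 <= P by apply: Rintegral_ge0 => t _; exact: sqr_ge0.
apply/cvgrPdist_le => /= e e0.
(* The weight [d] makes [d * P] at most [e / 2], the added 1 covering [P = 0]; the other term is at
   most [e / 2] once the squared distance is below [d * (e / 2)]. *)
pose d := e / (2 * (P + 1)).
have d0 : 0 < d by rewrite divr_gt0// mulr_gt0// ltr_wpDl.
have de0 : 0 < d * (e / 2) by rewrite mulr_gt0// divr_gt0.
near=> n.
(* Convergence to 0 in the extended reals makes the distances eventually finite, hence the
   difference square integrable for large [n]. *)
have D2 : square_integrable (fun t => u_ n t - u t).
  split; first by apply: measurable_funB => //; case: u2.
  apply/integrableP; split.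
    apply/measurable_EFinP; apply: measurable_funX.
    by apply: measurable_funB; [exact: mu_|case: u2].
  under eq_integral do rewrite /= ger0_norm ?sqr_ge0//.
  have : (\int[mu]_t ((u_ n t - u t) ^+ 2)%:E)%E \is a fin_num by near: n.
  by rewrite fin_numElt => /andP[].
have iD := @integrable_mul_L2 _ _ D2 p2.
have iup := @integrable_mul_L2 _ _ u2 p2.
have -> : \int[mu]_t (u t * p t) - \int[mu]_t (u_ n t * p t) =
    - \int[mu]_t ((u_ n t - u t) * p t).
  have -> : \int[mu]_t (u_ n t * p t) =
      \int[mu]_t ((u_ n t - u t) * p t + u t * p t).
    by apply: eq_Rintegral => t _; ring.
  by rewrite RintegralD//; ring.
rewrite normrN (le_trans (le_normr_Rintegral measurableT iD))//.
have i1 : mu.-integrable setT (EFin \o (fun t => d^-1 * (u_ n t - u t) ^+ 2)).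
  by case: D2 => _ h; exact: (integrableZl measurableT _ h).
have i2 : mu.-integrable setT (EFin \o (fun t => d * p t ^+ 2)).
  by case: p2 => _ h; exact: (integrableZl measurableT _ h).
apply: (@le_trans _ _ (\int[mu]_t (d^-1 * (u_ n t - u t) ^+ 2 + d * p t ^+ 2))).
  apply: le_Rintegral => //.
  - exact: integrable_norm.
  - exact: (integrableD measurableT i1 i2).
  - move=> t _; rewrite normrM.
    (* AM-GM: [2 |a| |b| <= a^2 / d + d b^2] *)
    rewrite -(real_normK (num_real (u_ n t - u t))).
    rewrite -(real_normK (num_real (p t))).
    move: `|u_ n t - u t| `|p t| (normr_ge0 (u_ n t - u t)) (normr_ge0 (p t)).
    move=> a b a0 b0.
    have -> : d^-1 * a ^+ 2 + d * b ^+ 2 = d^-1 * (a - d * b) ^+ 2 + 2 * (a * b).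
      by field; rewrite gt_eqF.
    have := mulr_ge0 a0 b0.
    have : 0 <= d^-1 * (a - d * b) ^+ 2 by rewrite mulr_ge0 ?sqr_ge0 ?invr_ge0 ?ltW.
    lra.
have [_ D2i] := D2; have [_ p2i] := p2.
rewrite RintegralD// !RintegralZl//.
rewrite [e]splitr lerD//.
  rewrite mulrC ler_pdivrMr// mulrC.
  rewrite (le_trans (ler_norm _))//.
  near: n; move/cvgr0_norm_le : cvg0; exact.
have P1 : 0 < P + 1 by rewrite ltr_wpDl.
rewrite -/P /d invfM mulrA -mulrA ler_piMr ?divr_ge0 ?(ltW e0)//.
by rewrite mulrC ler_pdivrMr// mul1r lerDl.
Unshelve. all: by end_near. Qed.

End square_integrable.

(** * Polynomials approximating a step function at 1/2 *)

Section bump.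
Context {R : realType}.
Implicit Types (x y : R) (n p : nat).

Lemma bernoulli_ge x n : 0 <= x -> 1 + n%:R * x <= (1 + x) ^+ n.
Proof.
move=> x0; elim: n => [|n IH]; first by rewrite mul0r addr0 expr0.
rewrite exprS (@le_trans _ _ ((1 + x) * (1 + n%:R * x)))//.
  by rewrite -natr1; have := mulr_ge0 (mulr_ge0 (ler0n R n) x0) x0; nra.
by rewrite ler_wpM2l// addr_ge0.
Qed.

Lemma bernoulli_le x n : 0 <= x <= 1 -> 1 - n%:R * x <= (1 - x) ^+ n.
Proof.
move=> /andP[x0 x1]; elim: n => [|n IH]; first by rewrite mul0r subr0 expr0.
rewrite exprS (@le_trans _ _ ((1 - x) * (1 - n%:R * x)))//.
  by rewrite -natr1; have := mulr_ge0 (mulr_ge0 (ler0n R n) x0) x0; nra.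
by rewrite ler_wpM2l// subr_ge0.
Qed.

(* As [p] grows, [bump p] tends to the indicator of [y > 1/2] on [0, 1]. *)
Definition bump p y : R := 1 - (1 - y ^+ p) ^+ (2 ^ p).

Lemma bump_itv p y : 0 <= y <= 1 -> 0 <= bump p y <= 1.
Proof.
move=> /andP[y0 y1]; rewrite subr_ge0 lerBlDr lerDl.
have yp : 0 <= 1 - y ^+ p <= 1.
  by rewrite subr_ge0 exprn_ile1//= lerBlDr lerDl exprn_ge0.
by case/andP: yp => a b; rewrite exprn_ile1//= exprn_ge0.
Qed.

(** Bernoulli's inequality bounds [bump p y] by [2^p y^p = (2 y)^p]; the exponent [2 ^ p] is what
    puts the threshold at 1/2. *)
Lemma cvg_bump_lt y : 0 <= y -> y < 2^-1 -> bump p y @[p --> \oo] --> (0 : R).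
Proof.
move=> y0 y2.
have y1 : y <= 1 by lra.
apply: (@squeeze_cvgr _ _ _ _ (cst 0) (fun p => (2 * y) ^+ p)).
- apply: nearW => p.
  have /andP[-> _] /= := @bump_itv p y ltac:(by rewrite y0 y1).
  rewrite /bump lerBlDr -lerBlDl exprMn -natrX.
  by apply: bernoulli_le; rewrite exprn_ge0//= exprn_ile1.
- exact: cvg_cst.
- by apply: cvg_expr; rewrite ger0_norm; lra.
Qed.

(** With [x = y^p] and [N = 2^p], the product [(1 - x)^N (1 + x)^N] is at most 1, while
    [(1 + x)^N >= N x = (2 y)^p] by Bernoulli. Hence [1 - bump p y] is at most [(2 y)^(-p)]. *)
Lemma cvg_bump_gt y : y <= 1 -> 2^-1 < y -> bump p y @[p --> \oo] --> (1 : R).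
Proof.
move=> y1 y2.
have y0 : 0 <= y by lra.
have z0 : 0 < 2 * y by lra.
apply: (@squeeze_cvgr _ _ _ _ (fun p => 1 - ((2 * y)^-1) ^+ p) (cst 1)).
- apply: nearW => p.
  have /andP[_ ->] /= := @bump_itv p y ltac:(by rewrite y0 y1).
  rewrite andbT /bump lerD2l lerN2 exprVn -[leRHS]mul1r ler_pdivlMr ?exprn_gt0//.
  set x := y ^+ p.
  have x0 : 0 <= x by rewrite exprn_ge0.
  have x1 : x <= 1 by rewrite exprn_ile1.
  rewrite exprMn -natrX -/x.
  rewrite (@le_trans _ _ ((1 - x) ^+ (2 ^ p) * (1 + x) ^+ (2 ^ p)))//.
    rewrite ler_wpM2l ?exprn_ge0 ?subr_ge0//.
    by rewrite (le_trans _ (@bernoulli_ge x (2 ^ p) x0))// lerDr.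
  by rewrite -exprMn exprn_ile1//; nra.
- rewrite -[X in _ --> X]subr0; apply: cvgB; first exact: cvg_cst.
  apply: cvg_expr; rewrite ger0_norm ?invr_ge0 ?ltW//.
  by rewrite invf_plt ?posrE// invr1; lra.
- exact: cvg_cst.
Qed.

(** The geometric factorisation of [1 - z^N] at [z = 1 - y^(p+1)]. The factor [y] is extracted
    because the vanishing moments this is used with have positive order; the index starts at [p.+1]
    because [bump 0] is constantly 1. *)
Lemma bump_horner p : exists P : {poly R}, forall y, bump p.+1 y = y * P.[y].
Proof.
exists ('X^p * \sum_(i < (2 ^ p.+1)%N) (1 - 'X^(p.+1)) ^+ i) => y.
have := subrXX 1 (1 - y ^+ p.+1) (2 ^ p.+1); rewrite expr1n /bump => ->.
have -> : 1 - (1 - y ^+ p.+1) = y * y ^+ p by rewrite exprS; ring.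
rewrite hornerM hornerXn -mulrA; congr (_ * (_ * _)).
rewrite horner_sum; apply: eq_bigr => i _.
by rewrite expr1n mul1r horner_exp hornerD hornerN hornerXn hornerC.
Qed.

End bump.

(** * Gaussians separate square integrable functions *)

Section totality.
Context {R : realType}.
Local Notation mu := (@lebesgue_measure R).
Implicit Types u h y : R -> R.

Lemma Rintegral_horner_eq0 h y : mu.-integrable setT (EFin \o h) ->
  measurable_fun setT y -> (forall t, 0 <= y t <= 1) ->
  (forall n, \int[mu]_t (h t * y t ^+ n.+1) = 0) ->
  forall P : {poly R}, \int[mu]_t (h t * (y t * P.[y t])) = 0.
Proof.
move=> ih my y01 h0 P.
have ihy n : mu.-integrable setT (EFin \o (fun t => h t * y t ^+ n)).
  apply: (@le_integrable_real _ _ (fun t => `|h t|)).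
  - apply: measurable_funM; first exact: integrable_measurable.
    exact: measurable_funX.
  - move=> t; have /andP[y0 y1] := y01 t.
    by rewrite normrM ler_piMr// normrX ger0_norm// exprn_ile1.
  - exact: integrable_norm.
(* The exponent is generalised before the induction on the polynomial, since [P * 'X + c] sends the
   power [n.+1] to [n.+2]. *)
suff H n : mu.-integrable setT (EFin \o (fun t => h t * y t ^+ n.+1 * P.[y t])) /\
    \int[mu]_t (h t * y t ^+ n.+1 * P.[y t]) = 0.
  have [_ <-] := H 0%N; apply: eq_Rintegral => t _.
  by rewrite expr1 mulrA.
elim/poly_ind: P n => [|P c IH] n.
  split.
    have := integrable0 mu [set: measurableTypeR R].
    by apply: eq_integrable => // t _ /=; rewrite horner0 mulr0.
  under eq_Rintegral do rewrite horner0 mulr0.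
  by rewrite Rintegral_cst// mul0r.
have [i1 e1] := IH n.+1.
have i2 : mu.-integrable setT (EFin \o (fun t => c * (h t * y t ^+ n.+1))).
  exact: (integrableZl measurableT c (ihy n.+1)).
have E t : h t * y t ^+ n.+1 * (P * 'X + c%:P).[y t] =
    h t * y t ^+ n.+2 * P.[y t] + c * (h t * y t ^+ n.+1).
  by rewrite hornerMXaddC [y t ^+ n.+2]exprSr; ring.
split.
  have := integrableD measurableT i1 i2.
  by apply: eq_integrable => // t _ /=; rewrite E.
under eq_Rintegral do rewrite E.
by rewrite RintegralD// e1 RintegralZl// h0 mulr0 addr0.
Qed.

(** Dominated convergence along [bump n.+1 (y t)], with bound [|h|]. The level set [y = 1/2] has to
    be null, because there the bumps tend to [1 - 1/e], which is neither value of the indicator. *)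
Lemma Rintegral_superlevel_eq0 h y : mu.-integrable setT (EFin \o h) ->
  measurable_fun setT y -> (forall t, 0 <= y t <= 1) ->
  {ae mu, forall t, y t != 2^-1} ->
  (forall n, \int[mu]_t (h t * y t ^+ n.+1) = 0) ->
  \int[mu]_(t in [set t | 2^-1 < y t]) h t = 0.
Proof.
move=> ih my y01 yae h0.
have mh := @integrable_measurable _ _ ih.
pose A := [set t | 2^-1 < y t].
have mA : measurable A.
  have := my measurableT [set` `]2^-1, +oo[] (measurable_itv _).
  rewrite setTI; congr (measurable _).
  by apply/seteqP; split => t /=; rewrite in_itv/= andbT.
rewrite Rintegral_mkcond -/A.
have mb n : measurable_fun setT (fun t => h t * bump n (y t)).
  apply: measurable_funM => //; apply: measurable_funB => //.
  apply: measurable_funX; apply: measurable_funB => //.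
  exact: measurable_funX.
have cvgb : {ae mu, forall t, setT t ->
    (h t * bump n.+1 (y t))%:E @[n --> \oo] --> ((h \_ A) t)%:E}.
  apply: filterS yae; first exact: (ae_filter_ringOfSetsType mu).
  move=> t yt _; apply: cvg_EFin; first exact: nearW.
  have /andP[y0 y1] := y01 t.
  rewrite (cvg_shiftS (fun n => h t * bump n (y t))).
  have [tA|tA] := boolP (t \in A).
    have -> : (h \_ A) t = h t * 1 by rewrite patchE tA mulr1.
    by apply: cvgMr; apply: cvg_bump_gt => //; move: tA; rewrite inE.
  have -> : (h \_ A) t = h t * 0 by rewrite patchE (negbTE tA) mulr0.
  apply: cvgMr; apply: cvg_bump_lt => //.
  by move: tA; rewrite notin_setE /A/= => /negP; rewrite -leNgt lt_neqAle yt.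
have bub : {ae mu, forall t n, setT t ->
    (`|(h t * bump n.+1 (y t))%:E| <= `|h t|%:E)%E}.
  apply: aeW => t n _; have /andP[b0 b1] := @bump_itv _ n.+1 _ (y01 t).
  by rewrite /= lee_fin normrM ler_piMr// ger0_norm.
have mhA : measurable_fun setT (EFin \o (h \_ A)).
  apply/measurable_EFinP/(measurable_restrictT _ _).1 => //.
  exact: measurable_funTS.
have [_ _ /= cv] := @dominated_convergence _ _ _ mu _ measurableT _ _ _
  (fun n => (measurable_EFinP _ _).2 (mb n.+1)) mhA cvgb (integrable_norm ih) bub.
have E n : (\int[mu]_t (h t * bump n.+1 (y t))%:E)%E = 0%E.
  have [P PE] := @bump_horner R n.
  have := Rintegral_horner_eq0 h y ih my y01 h0 P.
  under eq_Rintegral do rewrite -PE.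
  rewrite /Rintegral => h1; rewrite -[LHS]fineK ?h1//.
  apply: integrable_fin_num => //.
  apply: (@le_integrable_real _ _ (fun t => `|h t|)) => //.
  - move=> t; have /andP[b0 b1] := @bump_itv _ n.+1 _ (y01 t).
    by rewrite normrM ler_piMr// ger0_norm.
  - exact: integrable_norm.
move: cv; under eq_cvg do rewrite E.
move=> /(cvg_unique _ (cvg_cst _)) H.
by rewrite /Rintegral -H.
Qed.

(** [davg h x r] averages [|h - h x|] over the ball. Since the integral of [h] there is 0, this
    average is at least [|h x|]; at a Lebesgue point it tends to 0. *)
Lemma ball_integrals_eq0_ae h : mu.-integrable setT (EFin \o h) ->
  (forall a r, 0 < r -> \int[mu]_(t in ball a r) h t = 0) ->
  {ae mu, forall t, h t = 0}.
Proof.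
move=> ih h0.
have mh := @integrable_measurable _ _ ih.
have loc : locally_integrable setT h.
  have := @integrable_locally _ h setT measurableT ih.
  by rewrite patch_setT.
apply: filterS (lebesgue_differentiation loc).
  exact: (ae_filter_ringOfSetsType mu).
move=> x lx.
have lb : \forall r \near (0 : R)^'+, (`|h x|%:E <= davg h x r)%E.
  near=> r.
  have r0 : 0 < r by near: r; exact: nbhs_right_gt.
  have mB : measurable (ball x r) by exact: measurable_ball.
  have mBE : mu (ball x r) = (r *+ 2)%:E by exact: lebesgue_measure_ball (ltW r0).
  have ihB : mu.-integrable (ball x r) (EFin \o h) by exact: integrableS ih.
  have icB : mu.-integrable (ball x r) (EFin \o cst (h x)).
    apply: measurable_bounded_integrable => //.
      by rewrite [ltLHS]mBE ltry.
    exact: bounded_cst.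
  rewrite /davg /iavg lebesgue_measure_ball ?(ltW r0)//.
  have r2 : r *+ 2 != 0 by rewrite mulrn_eq0/= gt_eqF.
  have r20 : 0 < r *+ 2 by rewrite mulrn_wgt0.
  rewrite inver (negbTE r2) -lee_pdivrMl// ?invr_gt0// invrK -EFinM.
  have id : mu.-integrable (ball x r) (EFin \o (fun t => h t - h x)).
    have : mu.-integrable (ball x r) ((EFin \o h) \- (EFin \o cst (h x)))%E.
      exact: integrableB.
    by apply: eq_integrable.
  apply: le_trans (le_abse_integral mu mB (measurable_int _ id)).
  rewrite -EFin_normr_Rintegral// lee_fin RintegralB// h0// sub0r normrN.
  rewrite Rintegral_cst// [X in fine X]mBE/= normrM.
  by rewrite (gtr0_norm r20) mulrC.
have : (`|h x|%:E <= lim (davg h x r @[r --> (0 : R)^'+]))%E.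
  by apply: lime_ge => //; apply/cvg_ex; exists 0%E.
rewrite (cvg_lim _ lx)// lee_fin normr_le0 => /eqP//.
Unshelve. all: by end_near. Qed.

(** Completing the square in [t ^+ 2 / 2 + B * (t - a) ^+ 2]: the leading coefficient is [A], the
    centre [B * a / A], and [A = 1 / (2 s^2)] determines [s]. Thus every power of [y], weighted by
    the fixed Gaussian, is again a multiple of a single Gaussian. *)
Lemma normal_fun_mul (a k : R) n : 0 < k ->
  exists m s C : R, s != 0 /\ forall t,
    normal_fun 0 1 t * expR (- (k * (t - a) ^+ 2)) ^+ n = C * normal_fun m s t.
Proof.
move=> k0; pose B := n%:R * k; pose A := B + 2^-1.
have B0 : 0 <= B by rewrite mulr_ge0// ltW.
have A0 : 0 < A by rewrite ltr_wpDl.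
exists (B * a / A), (Num.sqrt (2 * A)^-1), (expR (B ^+ 2 * a ^+ 2 / A - B * a ^+ 2)).
have s0 : 0 < (2 * A)^-1 by rewrite invr_gt0 mulr_gt0.
split; first by rewrite gt_eqF// sqrtr_gt0.
move=> t; rewrite -expRM_natl -!expRD; congr expR.
rewrite sqr_sqrtr ?ltW// expr1n subr0 -/B.
have -> : n%:R * - (k * (t - a) ^+ 2) = - (B * (t - a) ^+ 2) by rewrite /B; ring.
have -> : B = A - 2^-1 by rewrite /A addrK.
by field; rewrite gt_eqF.
Qed.

Lemma square_integrable_normal_fun (m s : R) : s != 0 ->
  square_integrable (normal_fun m s).
Proof.
move=> s0; apply: (@square_integrable_bounded _ _ 1).
  by move=> t; rewrite ger0_norm ?normal_fun_ge0 ?normal_fun_le1.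
exact: integrable_normal_fun.
Qed.

Lemma normal_fun_total u : square_integrable u ->
  (forall m s : R, s != 0 -> \int[mu]_t (u t * normal_fun m s t) = 0) ->
  {ae mu, forall t, u t = 0}.
Proof.
move=> u2 u0.
(* The weight never vanishes, so [h = 0] almost everywhere gives back [u = 0]. *)
pose h t := u t * normal_fun 0 1 t.
have ih : mu.-integrable setT (EFin \o h).
  exact/integrable_mul_L2/square_integrable_normal_fun/oner_neq0.
suff : {ae mu, forall t, h t = 0}.
  apply: filterS; first exact: (ae_filter_ringOfSetsType mu).
  move=> t /eqP; rewrite mulf_eq0 [X in _ || X]gt_eqF ?normal_fun_gt0//.
  by rewrite orbF => /eqP.
apply: ball_integrals_eq0_ae => // a r r0.
(* Chosen so that [y] equals 1/2 exactly at distance [r] from [a]: the ball is a superlevel set, and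
   the level set consists of its two endpoints. *)
pose k := ln 2 / r ^+ 2.
have ln2 : 0 < ln (2 : R) by rewrite ln_gt0// ltr1n.
have k0 : 0 < k by rewrite divr_gt0// exprn_gt0.
pose y t := expR (- (k * (t - a) ^+ 2)).
have half : 2^-1 = expR (- (k * r ^+ 2)).
  by rewrite divfK ?expf_neq0 ?gt_eqF// expRN lnK// posrE.
have -> : ball a r = [set t | 2^-1 < y t].
  apply/seteqP; split => t /=; rewrite half ltr_expR ltrN2 ltr_pM2l// -ball_normE/=.
    rewrite distrC -(real_normK (num_real (t - a))) => tr.
    by rewrite ltr_pXn2r// nnegrE ltW.
  rewrite distrC -(real_normK (num_real (t - a))).
  by rewrite ltr_pXn2r// nnegrE ltW.
apply: Rintegral_superlevel_eq0 => //.
- apply: measurableT_comp => //; apply: measurableT_comp => //.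
  apply: measurable_funM => //; apply: measurable_funX; exact: measurable_funB.
- by move=> t; rewrite expR_ge0/= -expR0 ler_expR oppr_le0 mulr_ge0 ?sqr_ge0// ltW.
- exists [set a - r; a + r]; split.
  + by apply: measurableU; exact: measurable_set1.
  + apply: countable_lebesgue_measure0; exact: finite_set_countable.
  + move=> t /= /negP; rewrite negbK half => /eqP/expR_inj/oppr_inj.
    move=> /(mulfI (lt0r_neq0 k0)) /eqP; rewrite eqf_sqr => /orP[]/eqP E.
      by right; rewrite -E addrC subrK.
    by left; rewrite -E addrC subrK.
- move=> n; have [m [s [C [s0 E]]]] := @normal_fun_mul a k n.+1 k0.
  under eq_Rintegral do rewrite /h -mulrA E mulrCA.
  rewrite RintegralZl ?u0 ?mulr0//.
  exact/integrable_mul_L2/square_integrable_normal_fun.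
Qed.

End totality.

(** * Real and imaginary parts of the Fourier transform *)

Section fourier_duality.
Context {R : realType}.
Local Notation mu := (@lebesgue_measure R).
Implicit Types (f F : R -> R[i]) (p q : R -> R).

Lemma normc_sqr (z : R[i]) :
  Normc.normc z ^+ 2 = complex.Re z ^+ 2 + complex.Im z ^+ 2.
Proof. by case: z => a b /=; rewrite sqr_sqrtr// addr_ge0// sqr_ge0. Qed.

Lemma in_L2_square_integrable f : in_L2 f ->
  square_integrable (fun t => complex.Re (f t)) /\
  square_integrable (fun t => complex.Im (f t)).
Proof.
move=> [[mr mi] f2].
have if2 : mu.-integrable setT (EFin \o (fun t => Normc.normc (f t) ^+ 2)).
  apply/integrableP; split.
    apply/measurable_EFinP; under eq_fun do rewrite normc_sqr.
    by apply: measurable_funD; exact: measurable_funX.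
  by under eq_integral do rewrite /= ger0_norm ?sqr_ge0//.
split; split=> //; apply: le_integrable_real if2.
- exact: measurable_funX.
- by move=> t; rewrite ger0_norm ?sqr_ge0// normc_sqr lerDl sqr_ge0.
- exact: measurable_funX.
- by move=> t; rewrite ger0_norm ?sqr_ge0// normc_sqr lerDr sqr_ge0.
Qed.

Lemma in_L1_integrable f : in_L1 f ->
  mu.-integrable setT (EFin \o (fun t => complex.Re (f t))) /\
  mu.-integrable setT (EFin \o (fun t => complex.Im (f t))).
Proof.
move=> [[mr mi] f1].
have ge_sqrt (x y : R) : 0 <= y -> `|x| <= Num.sqrt (x ^+ 2 + y).
  by move=> y0; rewrite -sqrtr_sqr ler_wsqrtr// lerDl.
have if1 : mu.-integrable setT (EFin \o (fun t => Normc.normc (f t))).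
  apply/integrableP; split.
    apply/measurable_EFinP.
    have E t : Normc.normc (f t) =
        Num.sqrt (complex.Re (f t) ^+ 2 + complex.Im (f t) ^+ 2).
      by case: (f t).
    under eq_fun do rewrite E.
    apply: measurableT_comp.
      by apply: continuous_measurable_fun; exact: sqrt_continuous.
    by apply: measurable_funD; exact: measurable_funX.
  apply: le_lt_trans f1; rewrite le_eqVlt; apply/orP; left; apply/eqP.
  apply: eq_integral => t _ /=; rewrite ger0_norm//.
  by case: (f t) => a b; exact: sqrtr_ge0.
split; apply: le_integrable_real if1 => // t; case: (f t) => a b /=.
  exact/ge_sqrt/sqr_ge0.
by rewrite addrC; exact/ge_sqrt/sqr_ge0.
Qed.

Lemma Re_fourier_integral f w : in_L1 f ->
  complex.Re (fourier_integral f w) =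
  \int[mu]_t (complex.Re (f t) * cos (w * t)) +
  \int[mu]_t (complex.Im (f t) * sin (w * t)).
Proof.
move=> /in_L1_integrable[iu iv]; rewrite /fourier_integral/=.
rewrite -RintegralD//.
- apply: eq_Rintegral => t _; case: (f t) => a b /=.
  by rewrite cosN sinN mulrN opprK.
- by apply: integrable_kernel => //; [exact: continuous_cos|
    move=> x; rewrite ler_norml cos_geN1 cos_le1].
- by apply: integrable_kernel => //; [exact: continuous_sin|
    move=> x; rewrite ler_norml sin_geN1 sin_le1].
Qed.

Lemma Im_fourier_integral f w : in_L1 f ->
  complex.Im (fourier_integral f w) =
  \int[mu]_t (complex.Im (f t) * cos (w * t)) -
  \int[mu]_t (complex.Re (f t) * sin (w * t)).
Proof.
move=> /in_L1_integrable[iu iv]; rewrite /fourier_integral/=.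
rewrite -RintegralB//.
- apply: eq_Rintegral => t _; case: (f t) => a b /=.
  by rewrite cosN sinN mulrN addrC.
- by apply: integrable_kernel => //; [exact: continuous_cos|
    move=> x; rewrite ler_norml cos_geN1 cos_le1].
- by apply: integrable_kernel => //; [exact: continuous_sin|
    move=> x; rewrite ler_norml sin_geN1 sin_le1].
Qed.

Lemma integrable_mul_kernel_transform (u k p : R -> R) :
  mu.-integrable setT (EFin \o u) -> continuous k -> (forall x, `|k x| <= 1) ->
  mu.-integrable setT (EFin \o p) ->
  mu.-integrable setT (EFin \o (fun w : R => p w * \int[mu]_t (u t * k (w * t)))).
Proof.
move=> iu ck k1 ip.
have : mu.-integrable setT
    (EFin \o (fun w : R => (\int[mu]_t (u t * k (w * t))) * p w)).
  apply: (@integrable_mul_bounded _ _ _ (\int[mu]_t `|u t|)) => //.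
  - by apply: continuous_measurable_fun; exact: continuous_Rintegral_kernel.
  - move=> w; have iuk := @integrable_kernel _ u k iu ck k1 w.
    rewrite (le_trans (le_normr_Rintegral measurableT iuk))//.
    apply: le_Rintegral => //; [exact: integrable_norm|exact: integrable_norm|].
    by move=> t _; rewrite normrM ler_piMr.
by apply: eq_integrable => // w _ /=; rewrite mulrC.
Qed.

(** Both parts are sums or differences of continuous functions of the frequency. Measurability is
    needed to compare the L^2 distance with those of the real and imaginary parts. *)
Lemma cmeasurable_fourier_integral f : in_L1 f -> cmeasurable (fourier_integral f).
Proof.
move=> L1; have [i1 i2] := in_L1_integrable _ L1.
have mk u k : mu.-integrable setT (EFin \o u) -> continuous k ->
    (forall x, `|k x| <= 1) ->
    measurable_fun setT (fun w : R => \int[mu]_t (u t * k (w * t))).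
  move=> iu ck k1; apply: continuous_measurable_fun.
  exact: continuous_Rintegral_kernel.
have mc u iu := mk u cos iu (@continuous_cos R)
  (fun x => ltac:(by rewrite ler_norml cos_geN1 cos_le1)).
have ms u iu := mk u sin iu (@continuous_sin R)
  (fun x => ltac:(by rewrite ler_norml sin_geN1 sin_le1)).
split.
- under eq_fun do rewrite Re_fourier_integral//.
  by apply: measurable_funD; [exact: mc|exact: ms].
- under eq_fun do rewrite Im_fourier_integral//.
  by apply: measurable_funB; [exact: mc|exact: ms].
Qed.

Lemma cvg_L2_components (g_ : nat -> R -> R[i]) (g : R -> R[i]) :
  (forall n, cmeasurable (g_ n)) -> cmeasurable g -> cvg_L2 g_ g ->
  (\int[mu]_t ((complex.Re (g_ n t) - complex.Re (g t)) ^+ 2)%:E)%E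
    @[n --> \oo] --> 0%E /\
  (\int[mu]_t ((complex.Im (g_ n t) - complex.Im (g t)) ^+ 2)%:E)%E
    @[n --> \oo] --> 0%E.
Proof.
move=> mg_ [mgr mgi] cg.
have E n t : Normc.normc (g_ n t - g t) ^+ 2 =
    (complex.Re (g_ n t) - complex.Re (g t)) ^+ 2 +
    (complex.Im (g_ n t) - complex.Im (g t)) ^+ 2.
  by rewrite normc_sqr; case: (g_ n t) (g t) => [a b] [c d].
have mr n : measurable_fun setT (fun t => (complex.Re (g_ n t) - complex.Re (g t)) ^+ 2).
  by apply: measurable_funX; apply: measurable_funB => //; case: (mg_ n).
have mi n : measurable_fun setT (fun t => (complex.Im (g_ n t) - complex.Im (g t)) ^+ 2).
  by apply: measurable_funX; apply: measurable_funB => //; case: (mg_ n).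
have mn n : measurable_fun setT (fun t => Normc.normc (g_ n t - g t) ^+ 2).
  by under eq_fun do rewrite E; exact: measurable_funD.
split; apply: squeeze_cvge (cvg_cst _) cg; apply: nearW => n;
  rewrite integral_ge0 ?andTb => [|t _]; rewrite ?lee_fin ?sqr_ge0//.
- apply: ge0_le_integral => //.
  + by move=> t _; rewrite lee_fin sqr_ge0.
  + by apply/measurable_EFinP; exact: mr.
  + by apply/measurable_EFinP; exact: mn.
  + by move=> t _; rewrite lee_fin E lerDl sqr_ge0.
- apply: ge0_le_integral => //.
  + by move=> t _; rewrite lee_fin sqr_ge0.
  + by apply/measurable_EFinP; exact: mi.
  + by apply/measurable_EFinP; exact: mn.
  + by move=> t _; rewrite lee_fin E lerDr sqr_ge0.
Qed.

(** * Transposition of the L^2 transform onto a real test function *)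

Section duality.
Variables (f F : R -> R[i]) (p pc ps : R -> R).
Hypothesis fF : is_fourier_transform f F.
Hypotheses (ip : mu.-integrable setT (EFin \o p)) (p2 : square_integrable p).
Hypotheses (pc2 : square_integrable pc) (ps2 : square_integrable ps).
Hypothesis pcE : forall t, \int[mu]_w (p w * cos (w * t)) = pc t.
Hypothesis psE : forall t, \int[mu]_w (p w * sin (w * t)) = ps t.

Let cos1 (x : R) : `|cos x| <= 1.
Proof. by rewrite ler_norml cos_geN1 cos_le1. Qed.

Let sin1 (x : R) : `|sin x| <= 1.
Proof. by rewrite ler_norml sin_geN1 sin_le1. Qed.

Let swap_cos u : mu.-integrable setT (EFin \o u) ->
  \int[mu]_w (p w * \int[mu]_t (u t * cos (w * t))) = \int[mu]_t (u t * pc t).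
Proof.
move=> iu; rewrite (@Rintegral_kernel_swap _ u cos iu (@continuous_cos R) cos1 p ip).
by apply: eq_Rintegral => t _; rewrite pcE.
Qed.

Let swap_sin u : mu.-integrable setT (EFin \o u) ->
  \int[mu]_w (p w * \int[mu]_t (u t * sin (w * t))) = \int[mu]_t (u t * ps t).
Proof.
move=> iu; rewrite (@Rintegral_kernel_swap _ u sin iu (@continuous_sin R) sin1 p ip).
by apply: eq_Rintegral => t _; rewrite psE.
Qed.

Let fourier_duality_L1 g : in_L1 g ->
  \int[mu]_w (complex.Re (fourier_integral g w) * p w) =
    \int[mu]_t (complex.Re (g t) * pc t) + \int[mu]_t (complex.Im (g t) * ps t) /\
  \int[mu]_w (complex.Im (fourier_integral g w) * p w) =
    \int[mu]_t (complex.Im (g t) * pc t) - \int[mu]_t (complex.Re (g t) * ps t).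
Proof.
move=> L1; have [i1 i2] := in_L1_integrable _ L1.
rewrite -!swap_cos// -!swap_sin// -RintegralD -?RintegralB//;
  try by apply: integrable_mul_kernel_transform => //;
    [exact: continuous_cos || exact: continuous_sin].
split; apply: eq_Rintegral => w _.
- by rewrite Re_fourier_integral// mulrC mulrDr.
- by rewrite Im_fourier_integral// mulrC mulrBr.
Qed.

(** These are the two parts of [int F p = int f (pc - i ps)], where [pc - i ps] is the Fourier
    integral of [p]. The identity holds for each approximant in L^1, and both sides pass to the L^2
    limit because [p], [pc] and [ps] are square integrable. *)
Lemma fourier_duality :
  \int[mu]_w (complex.Re (F w) * p w) =
    \int[mu]_t (complex.Re (f t) * pc t) + \int[mu]_t (complex.Im (f t) * ps t) /\
  \int[mu]_w (complex.Im (F w) * p w) =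
    \int[mu]_t (complex.Im (f t) * pc t) - \int[mu]_t (complex.Re (f t) * ps t).
Proof.
have [f2 F2 [f_ [f_L cf cF]]] := fF.
have [rf imf] := in_L2_square_integrable f f2.
have [rF iF] := in_L2_square_integrable F F2.
have L1 n : in_L1 (f_ n) := (f_L n).1.
have mf_ n : cmeasurable (f_ n) by case: (L1 n).
have mF_ n := cmeasurable_fourier_integral _ (L1 n).
have [cfr cfi] := cvg_L2_components _ _ mf_ f2.1 cf.
have [cFr cFi] := cvg_L2_components _ _ mF_ F2.1 cF.
have lim := cvg_Rintegral_mul_L2.
split.
- have cA := lim _ _ _ p (fun n => (mF_ n).1) rF p2 cFr.
  have cB : \int[mu]_t (complex.Re (f_ n t) * pc t) +
      \int[mu]_t (complex.Im (f_ n t) * ps t) @[n --> \oo] -->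
      \int[mu]_t (complex.Re (f t) * pc t) + \int[mu]_t (complex.Im (f t) * ps t).
    by apply: cvgD; apply: lim => // n; case: (mf_ n).
  move: cA; under eq_cvg do rewrite (fourier_duality_L1 _ (L1 _)).1.
  by move=> cA; exact: (cvg_unique _ cA cB).
- have cA := lim _ _ _ p (fun n => (mF_ n).2) iF p2 cFi.
  have cB : \int[mu]_t (complex.Im (f_ n t) * pc t) -
      \int[mu]_t (complex.Re (f_ n t) * ps t) @[n --> \oo] -->
      \int[mu]_t (complex.Im (f t) * pc t) - \int[mu]_t (complex.Re (f t) * ps t).
    by apply: cvgB; apply: lim => // n; case: (mf_ n).
  move: cA; under eq_cvg do rewrite (fourier_duality_L1 _ (L1 _)).2.
  by move=> cA; exact: (cvg_unique _ cA cB).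
Qed.

End duality.

End fourier_duality.

(** * Explicit cosine and sine transforms of Gaussians *)

Section gaussian_pairs.
Context {R : realType}.
Local Notation mu := (@lebesgue_measure R).
Implicit Types m s t : R.

(** [normal_cos m s - i normal_sin m s] is the Fourier integral of [normal_fun m s]: a Gaussian of
    width [s^-1], modulated by the centre [m]. *)
Definition normal_cos m s t : R :=
  (normal_peak s)^-1 * (cos (m * t) * normal_fun 0 s^-1 t).

Definition normal_sin m s t : R :=
  (normal_peak s)^-1 * (sin (m * t) * normal_fun 0 s^-1 t).

Lemma integrable_bounded_normal_fun (k : R -> R) m s : continuous k ->
  (forall x, `|k x| <= 1) -> s != 0 ->
  mu.-integrable setT (EFin \o (fun t => k t * normal_fun m s t)).
Proof.
move=> ck k1 s0; apply: (@integrable_mul_bounded _ _ _ 1) => //.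
  exact: continuous_measurable_fun.
exact: integrable_normal_fun.
Qed.

Let continuous_cosM m : continuous (fun t => cos (m * t)).
Proof.
move=> t; apply: (@continuous_comp _ _ _ (fun t : R => m * t) cos).
  by apply: cvgMr; exact: cvg_id.
exact: continuous_cos.
Qed.

Let continuous_sinM m : continuous (fun t => sin (m * t)).
Proof.
move=> t; apply: (@continuous_comp _ _ _ (fun t : R => m * t) sin).
  by apply: cvgMr; exact: cvg_id.
exact: continuous_sin.
Qed.

Let cos1 (x : R) : `|cos x| <= 1.
Proof. by rewrite ler_norml cos_geN1 cos_le1. Qed.

Let sin1 (x : R) : `|sin x| <= 1.
Proof. by rewrite ler_norml sin_geN1 sin_le1. Qed.

Lemma integrable_normal_cos m s : s != 0 ->
  mu.-integrable setT (EFin \o normal_cos m s).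
Proof.
move=> s0; apply: (integrableZl measurableT _ (f := EFin \o _)).
by apply: integrable_bounded_normal_fun => //; rewrite invr_eq0.
Qed.

Lemma integrable_normal_sin m s : s != 0 ->
  mu.-integrable setT (EFin \o normal_sin m s).
Proof.
move=> s0; apply: (integrableZl measurableT _ (f := EFin \o _)).
by apply: integrable_bounded_normal_fun => //; rewrite invr_eq0.
Qed.

Let peak_ge0 s : 0 <= (normal_peak s)^-1.
Proof. by rewrite invr_ge0 normal_peak_ge0. Qed.

Lemma square_integrable_normal_cos m s : s != 0 ->
  square_integrable (normal_cos m s).
Proof.
move=> s0; apply: (@square_integrable_bounded _ _ (normal_peak s)^-1).
  move=> t; rewrite normrM ger0_norm// ler_piMr// normrM mulr_ile1//.
  by rewrite ger0_norm ?normal_fun_ge0 ?normal_fun_le1.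
exact: integrable_normal_cos.
Qed.

Lemma square_integrable_normal_sin m s : s != 0 ->
  square_integrable (normal_sin m s).
Proof.
move=> s0; apply: (@square_integrable_bounded _ _ (normal_peak s)^-1).
  move=> t; rewrite normrM ger0_norm// ler_piMr// normrM mulr_ile1//.
  by rewrite ger0_norm ?normal_fun_ge0 ?normal_fun_le1.
exact: integrable_normal_sin.
Qed.

Lemma normal_fun0V s t : s != 0 ->
  normal_fun 0 s^-1 t = expR (- (s ^+ 2 * t ^+ 2 / 2)).
Proof.
by move=> s0; rewrite /normal_fun subr0; congr expR; field.
Qed.

Lemma cos_transform_normal_fun m s t : s != 0 ->
  \int[mu]_w (normal_fun m s w * cos (w * t)) = normal_cos m s t.
Proof.
move=> s0; rewrite /normal_cos normal_fun0V// [m * t]mulrC mulrCA mulrA.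
rewrite -Rintegral_cos_normal_fun//.
by apply: eq_Rintegral => w _; rewrite mulrC [w * t]mulrC.
Qed.

Lemma sin_transform_normal_fun m s t : s != 0 ->
  \int[mu]_w (normal_fun m s w * sin (w * t)) = normal_sin m s t.
Proof.
move=> s0; rewrite /normal_sin normal_fun0V// [m * t]mulrC mulrCA mulrA.
rewrite -Rintegral_sin_normal_fun//.
by apply: eq_Rintegral => w _; rewrite mulrC [w * t]mulrC.
Qed.

(** The source of the constant 2 pi: the masses of the Gaussians of widths [s] and [s^-1] are
    [sqrt (2 pi s^2)] and [sqrt (2 pi / s^2)]. *)
Lemma normal_peakV_mul s : s != 0 ->
  (normal_peak s)^-1 * (normal_peak s^-1)^-1 = 2 * pi.
Proof.
move=> s0; rewrite /normal_peak !invrK -sqrtrM; last first.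
  by rewrite mulrn_wge0// mulr_ge0 ?sqr_ge0 ?pi_ge0.
have -> : s ^+ 2 * pi *+ 2 * (s^-1 ^+ 2 * pi *+ 2) = (2 * pi) ^+ 2 by field.
by rewrite sqrtr_sqr ger0_norm// mulr_ge0 ?pi_ge0.
Qed.

Let cosT s (x : R) : s != 0 ->
  (normal_peak s)^-1 * \int[mu]_w (cos (x * w) * normal_fun 0 s^-1 w) =
  2 * pi * normal_fun 0 s x.
Proof.
move=> s0; have sV0 : s^-1 != 0 by rewrite invr_eq0.
rewrite Rintegral_cos_normal_fun// mulr0 cos0 mul1r mulrA normal_peakV_mul//.
by rewrite -normal_fun0V// invrK.
Qed.

Let sinT s (x : R) : s != 0 ->
  \int[mu]_w (sin (x * w) * normal_fun 0 s^-1 w) = 0.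
Proof.
move=> s0; have sV0 : s^-1 != 0 by rewrite invr_eq0.
by rewrite Rintegral_sin_normal_fun// mulr0 sin0 !mul0r.
Qed.

Let intcos s (x : R) : s != 0 ->
  mu.-integrable setT (EFin \o (fun w => cos (x * w) * normal_fun 0 s^-1 w)).
Proof.
by move=> s0; apply: integrable_bounded_normal_fun => //; rewrite invr_eq0.
Qed.

Let intsin s (x : R) : s != 0 ->
  mu.-integrable setT (EFin \o (fun w => sin (x * w) * normal_fun 0 s^-1 w)).
Proof.
by move=> s0; apply: integrable_bounded_normal_fun => //; rewrite invr_eq0.
Qed.

Let RintZ (c : R) (g : R -> R) : mu.-integrable setT (EFin \o g) ->
  \int[mu]_w (c * g w) = c * \int[mu]_w g w.
Proof. by move=> ig; rewrite RintegralZl. Qed.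

Let intZ (c : R) (g : R -> R) : mu.-integrable setT (EFin \o g) ->
  mu.-integrable setT (EFin \o (fun w => c * g w)).
Proof. by move=> ig; exact: (integrableZl measurableT c ig). Qed.

Let normal_fun_shift m s t : normal_fun 0 s (t - m) = normal_fun m s t.
Proof. by rewrite /normal_fun subr0. Qed.

Let normal_fun_shiftN m s t : normal_fun 0 s (t + m) = normal_fun (- m) s t.
Proof. by rewrite /normal_fun subr0 opprK. Qed.

(** The product-to-sum formula moves the modulation into the frequencies [t - m] and [t + m], which
    yields Gaussians centred at [m] and [- m]. Its factor 1/2 turns 2 pi into pi. *)
Lemma cos_transform_normal_cos m s t : s != 0 ->
  \int[mu]_w (normal_cos m s w * cos (w * t)) =
  pi * (normal_fun m s t + normal_fun (- m) s t).
Proof.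
move=> s0; pose K := 2^-1 * (normal_peak s)^-1.
have E w : normal_cos m s w * cos (w * t) =
    K * (cos ((t - m) * w) * normal_fun 0 s^-1 w) +
    K * (cos ((t + m) * w) * normal_fun 0 s^-1 w).
  rewrite /normal_cos mulrBl mulrDl cosB cosD [w * t]mulrC /K.
  by field; rewrite gt_eqF// normal_peak_gt0.
under eq_Rintegral do rewrite E.
rewrite RintegralD//; [|exact/intZ/intcos|exact/intZ/intcos].
rewrite !RintZ ?intcos// /K -!(mulrA 2^-1) !cosT//.
by rewrite normal_fun_shift normal_fun_shiftN; field.
Qed.

(** The product-to-sum formula leaves only sine transforms of a centred Gaussian, which vanish. *)
Lemma sin_transform_normal_cos m s t : s != 0 ->
  \int[mu]_w (normal_cos m s w * sin (w * t)) = 0.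
Proof.
move=> s0; pose K := 2^-1 * (normal_peak s)^-1.
have E w : normal_cos m s w * sin (w * t) =
    K * (sin ((t - m) * w) * normal_fun 0 s^-1 w) +
    K * (sin ((t + m) * w) * normal_fun 0 s^-1 w).
  rewrite /normal_cos mulrBl mulrDl sinB sinD [w * t]mulrC /K.
  by field; rewrite gt_eqF// normal_peak_gt0.
under eq_Rintegral do rewrite E.
rewrite RintegralD//; [|exact/intZ/intsin|exact/intZ/intsin].
by rewrite !RintZ ?intsin// !sinT// mulr0 addr0.
Qed.

Lemma cos_transform_normal_sin m s t : s != 0 ->
  \int[mu]_w (normal_sin m s w * cos (w * t)) = 0.
Proof.
move=> s0; pose K := 2^-1 * (normal_peak s)^-1.
have E w : normal_sin m s w * cos (w * t) =
    K * (sin ((t + m) * w) * normal_fun 0 s^-1 w) -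
    K * (sin ((t - m) * w) * normal_fun 0 s^-1 w).
  rewrite /normal_sin mulrBl mulrDl sinB sinD [w * t]mulrC /K.
  by field; rewrite gt_eqF// normal_peak_gt0.
under eq_Rintegral do rewrite E.
rewrite RintegralB//; [|exact/intZ/intsin|exact/intZ/intsin].
by rewrite !RintZ ?intsin// !sinT// mulr0 subr0.
Qed.

Lemma sin_transform_normal_sin m s t : s != 0 ->
  \int[mu]_w (normal_sin m s w * sin (w * t)) =
  pi * (normal_fun m s t - normal_fun (- m) s t).
Proof.
move=> s0; pose K := 2^-1 * (normal_peak s)^-1.
have E w : normal_sin m s w * sin (w * t) =
    K * (cos ((t - m) * w) * normal_fun 0 s^-1 w) -
    K * (cos ((t + m) * w) * normal_fun 0 s^-1 w).
  rewrite /normal_sin mulrBl mulrDl cosB cosD [w * t]mulrC /K.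
  by field; rewrite gt_eqF// normal_peak_gt0.
under eq_Rintegral do rewrite E.
rewrite RintegralB//; [|exact/intZ/intcos|exact/intZ/intcos].
rewrite !RintZ ?intcos// /K -!(mulrA 2^-1) !cosT//.
by rewrite normal_fun_shift normal_fun_shiftN; field.
Qed.

End gaussian_pairs.

(** * Complex pairings and the modulus of the eigenvalue *)

Section pairing.
Context {R : realType}.
Local Notation mu := (@lebesgue_measure R).
Implicit Types (f F : R -> R[i]) (p q : R -> R).

(** Bilinear rather than sesquilinear: lambda comes out without conjugation, so using the relation
    twice produces [lambda ^+ 2]. *)
Definition pairing f p : R[i] :=
  Complex (\int[mu]_t (complex.Re (f t) * p t)) (\int[mu]_t (complex.Im (f t) * p t)).

Lemma pairing0 f : pairing f (cst 0) = 0.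
Proof.
rewrite /pairing.
under eq_Rintegral do rewrite mulr0.
under [X in Complex _ X]eq_Rintegral do rewrite mulr0.
by rewrite Rintegral_cst// mul0r.
Qed.

Lemma pairingD f p q : in_L2 f -> square_integrable p -> square_integrable q ->
  pairing f (fun t => p t + q t) = pairing f p + pairing f q.
Proof.
move=> /in_L2_square_integrable[rf jf] p2 q2.
rewrite /pairing.
under eq_Rintegral do rewrite mulrDr.
under [X in Complex _ X]eq_Rintegral do rewrite mulrDr.
by rewrite !RintegralD//; exact: integrable_mul_L2.
Qed.

Lemma pairingZ f (c : R) p : in_L2 f -> square_integrable p ->
  pairing f (fun t => c * p t) = Complex c 0 * pairing f p.
Proof.
move=> /in_L2_square_integrable[rf jf] p2.
rewrite /pairing.
under eq_Rintegral do rewrite mulrCA.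
under [X in Complex _ X]eq_Rintegral do rewrite mulrCA.
rewrite !RintegralZl//; [|exact: integrable_mul_L2|exact: integrable_mul_L2].
by apply/eqP; rewrite eq_complex/= !mul0r subr0 addr0 !eqxx.
Qed.

Lemma square_integrableZ (c : R) p : square_integrable p ->
  square_integrable (fun t => c * p t).
Proof.
move=> [mp p2]; split; first exact: measurable_funM.
have := integrableZl measurableT (c ^+ 2) p2.
by apply: eq_integrable => // t _ /=; rewrite exprMn.
Qed.

Lemma square_integrableD p q : square_integrable p -> square_integrable q ->
  square_integrable (fun t => p t + q t).
Proof.
move=> p2 q2; have ipq := integrable_mul_L2 _ _ p2 q2.
move: p2 q2 => [mp p2] [mq q2]; split; first exact: measurable_funD.
have := integrableD measurableT (integrableD measurableT p2 q2)
  (integrableZl measurableT 2 ipq).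
by apply: eq_integrable => // t _ /=; congr EFin; ring.
Qed.

Lemma square_integrable0 : square_integrable (cst 0 : R -> R).
Proof.
split=> //; have := integrable0 mu [set: measurableTypeR R].
by apply: eq_integrable => // t _ /=; rewrite expr0n.
Qed.

Lemma pairing_fourier f F p pc ps : is_fourier_transform f F ->
  mu.-integrable setT (EFin \o p) -> square_integrable p ->
  square_integrable pc -> square_integrable ps ->
  (forall t, \int[mu]_w (p w * cos (w * t)) = pc t) ->
  (forall t, \int[mu]_w (p w * sin (w * t)) = ps t) ->
  pairing F p = pairing f pc - 'i%C * pairing f ps.
Proof.
move=> fF ip p2 pc2 ps2 pcE psE.
have [er ei] := fourier_duality f F p pc ps fF ip p2 pc2 ps2 pcE psE.
apply/eqP; rewrite eq_complex/= er ei.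
by apply/andP; split; apply/eqP; ring.
Qed.

Lemma ae_eq_Rintegral (u v : R -> R) : measurable_fun setT u ->
  measurable_fun setT v -> {ae mu, forall t, u t = v t} ->
  \int[mu]_t u t = \int[mu]_t v t.
Proof.
move=> mu_ mv uv; congr fine; apply: ae_eq_integral => //.
- exact/measurable_EFinP.
- exact/measurable_EFinP.
- apply: filterS uv; first exact: (ae_filter_ringOfSetsType mu).
  by move=> t -> _.
Qed.

Lemma pairing_ae_scale f F (lambda : R[i]) p : in_L2 f -> in_L2 F ->
  square_integrable p -> {ae mu, forall t, F t = lambda * f t} ->
  pairing F p = lambda * pairing f p.
Proof.
case: lambda => a b f2 F2 p2 Ff.
have [[mRf _] [mIf _]] := in_L2_square_integrable _ f2.
have [mp _] := p2.
have ir : mu.-integrable setT (EFin \o (fun t => complex.Re (f t) * p t)).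
  by apply: integrable_mul_L2 => //; case: (in_L2_square_integrable _ f2).
have ii : mu.-integrable setT (EFin \o (fun t => complex.Im (f t) * p t)).
  by apply: integrable_mul_L2 => //; case: (in_L2_square_integrable _ f2).
have iZ (c : R) (g : R -> R) : mu.-integrable setT (EFin \o g) ->
    mu.-integrable setT (EFin \o (fun t => c * g t)).
  by move=> ig; exact: (integrableZl measurableT c ig).
apply/eqP; rewrite eq_complex/=; apply/andP; split; apply/eqP.
- rewrite -!RintegralZl// -RintegralB//; [|exact: iZ|exact: iZ].
  apply: ae_eq_Rintegral.
  + by apply: measurable_funM => //; case: F2 => -[].
  + by apply: measurable_funB; apply: measurable_funM => //; exact: measurable_funM.
  + apply: filterS Ff; first exact: (ae_filter_ringOfSetsType mu).
    by move=> t ->; case: (f t) => c d /=; ring.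
- rewrite -!RintegralZl// -RintegralD//; [|exact: iZ|exact: iZ].
  apply: ae_eq_Rintegral.
  + by apply: measurable_funM => //; case: F2 => -[].
  + by apply: measurable_funD; apply: measurable_funM => //; exact: measurable_funM.
  + apply: filterS Ff; first exact: (ae_filter_ringOfSetsType mu).
    by move=> t ->; case: (f t) => c d /=; ring.
Qed.

(** Write [a], [b] for the pairings with the Gaussians at [m] and [- m], and [c], [d] for those with
    [normal_cos] and [normal_sin]. Transposition gives [lambda a = c - i d], [lambda c = pi (a + b)]
    and [lambda d = - i pi (a - b)]; eliminating [c] and [d] leaves [lambda^2 a = 2 pi b]. *)
Lemma fourier_eigen_gaussian f F (lambda : R[i]) (m s : R) :
  in_L2 f -> is_fourier_transform f F ->
  {ae mu, forall t, F t = lambda * f t} -> s != 0 ->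
  lambda ^+ 2 * pairing f (normal_fun m s) =
  Complex (2 * pi) 0 * pairing f (normal_fun (- m) s).
Proof.
move=> f2 fF Ff s0; have [_ F2 _] := fF.
have g2 (x : R) := square_integrable_normal_fun x s s0.
have c2 := square_integrable_normal_cos m s s0.
have s2 := square_integrable_normal_sin m s s0.
have ND2 : square_integrable (fun t => pi * (normal_fun m s t + normal_fun (- m) s t)).
  exact/square_integrableZ/square_integrableD.
have NB2 : square_integrable (fun t =>
    pi * (normal_fun m s t + -1 * normal_fun (- m) s t)).
  exact/square_integrableZ/square_integrableD/square_integrableZ.
have e1 := pairing_fourier f F _ _ _ fF (integrable_normal_fun m s s0) (g2 m) c2 s2
  (fun t => cos_transform_normal_fun m s t s0)
  (fun t => sin_transform_normal_fun m s t s0).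
have e2 := pairing_fourier f F _ _ _ fF (integrable_normal_cos m s s0) c2 ND2
  square_integrable0
  (fun t => cos_transform_normal_cos m s t s0)
  (fun t => sin_transform_normal_cos m s t s0).
(* The difference is written as a sum with coefficient [-1] so that [pairingD] and [pairingZ]
   apply. *)
have sE t : \int[mu]_w (normal_sin m s w * sin (w * t)) =
    pi * (normal_fun m s t + -1 * normal_fun (- m) s t).
  by rewrite sin_transform_normal_sin// mulN1r.
have e3 := pairing_fourier f F _ _ _ fF (integrable_normal_sin m s s0) s2
  square_integrable0 NB2 (fun t => cos_transform_normal_sin m s t s0) sE.
rewrite !(pairing_ae_scale f F lambda)// in e1 e2 e3.
rewrite pairing0 mulr0 subr0 in e2; rewrite pairing0 sub0r in e3.
have e2' : pairing f (fun t => pi * (normal_fun m s t + normal_fun (- m) s t)) =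
    Complex pi 0 * (pairing f (normal_fun m s) + pairing f (normal_fun (- m) s)).
  by rewrite pairingZ ?pairingD//; exact: square_integrableD.
have e3' : pairing f (fun t => pi * (normal_fun m s t + -1 * normal_fun (- m) s t)) =
    Complex pi 0 *
    (pairing f (normal_fun m s) + Complex (-1) 0 * pairing f (normal_fun (- m) s)).
  have N2 := square_integrableZ (-1) _ (g2 (- m)).
  by rewrite pairingZ ?pairingD ?pairingZ//; exact: square_integrableD.
rewrite {}e2' in e2; rewrite {}e3' in e3.
move: (pairing f (normal_cos m s)) (pairing f (normal_sin m s)) e1 e2 e3.
move=> c d e1 e2 e3.
move: (pairing f (normal_fun m s)) (pairing f (normal_fun (- m) s)) e1 e2 e3.
move=> a b e1 e2 e3.
rewrite expr2 -mulrA e1 mulrBr e2 mulrCA e3.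
case: a b {e1 e2 e3} => [a1 a2] [b1 b2].
by apply/eqP; rewrite eq_complex/=; apply/andP; split; apply/eqP; ring.
Qed.

Lemma fourier_eigenvalue_norm f F (lambda : R[i]) :
  in_L2 f -> ~ {ae mu, forall t, f t = 0} -> is_fourier_transform f F ->
  {ae mu, forall t, F t = lambda * f t} -> Normc.normc lambda ^+ 2 = 2 * pi.
Proof.
move=> f2 fn0 fF Ff.
have [m [s [s0 a0]]] : exists m s : R, s != 0 /\ pairing f (normal_fun m s) != 0.
  apply: contrapT => H; apply: fn0.
  have P0 (m s : R) : s != 0 -> pairing f (normal_fun m s) = 0.
    by move=> s0; apply: contrapT => /eqP n0; apply: H; exists m, s.
  have [rf jf] := in_L2_square_integrable _ f2.
  have r0 : {ae mu, forall t, complex.Re (f t) = 0}.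
    by apply: normal_fun_total => // m s s0; case: (P0 m s s0).
  have i0 : {ae mu, forall t, complex.Im (f t) = 0}.
    by apply: normal_fun_total => // m s s0; case: (P0 m s s0).
  apply: filterS2 r0 i0; first exact: (ae_filter_ringOfSetsType mu).
  by move=> t; case: (f t) => a b /= -> ->.
have e1 := fourier_eigen_gaussian f F lambda m s f2 fF Ff s0.
have e2 := fourier_eigen_gaussian f F lambda (- m) s f2 fF Ff s0.
rewrite opprK in e2.
have pi0 : 0 <= 2 * pi :> R by rewrite mulr_ge0 ?pi_ge0.
have L4 : (lambda ^+ 2) * (lambda ^+ 2) = Complex (2 * pi) 0 * Complex (2 * pi) 0.
  by apply: (mulIf a0); rewrite -mulrA e1 mulrCA e2 mulrA.
(* The fourth power determines lambda only up to a fourth root of unity; taking moduli removes this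
   ambiguity. *)
have := congr1 (@Normc.normc R) L4; rewrite expr2 !Normc.normcM/= -!expr2.
rewrite expr0n/= addr0 sqrtr_sqr => /eqP; rewrite eqrXn2//.
- by rewrite (ger0_norm pi0) => /eqP.
- exact: sqr_ge0.
Qed.

(** The second moments have to agree as extended reals so that both sides take the same branch. For
    the other integrals the equality holds before [fine], so the sides agree also where [fine]
    returns its default value. *)
Lemma std_dev_ae_eq p q : measurable_fun setT p -> measurable_fun setT q ->
  {ae mu, forall t, p t = q t} -> std_dev p = std_dev q.
Proof.
move=> mp mq pq.
have S : second_moment p = second_moment q.
  apply: ae_eq_integral => //.
  - by apply/measurable_EFinP; apply: measurable_funM => //; exact: measurable_funX.
  - by apply/measurable_EFinP; apply: measurable_funM => //; exact: measurable_funX.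
  - apply: filterS pq; first exact: (ae_filter_ringOfSetsType mu).
    by move=> t -> _.
have M : mean p = mean q.
  apply: ae_eq_Rintegral; [exact: measurable_funM|exact: measurable_funM|].
  by apply: filterS pq; [exact: (ae_filter_ringOfSetsType mu)|move=> t ->].
rewrite /std_dev S M; case: ifP => // _; congr (_%:E); congr Num.sqrt.
have mX : measurable_fun setT (fun x : R => (x - mean q) ^+ 2).
  by apply: measurable_funX; exact: measurable_funB.
apply: ae_eq_Rintegral; [exact: measurable_funM|exact: measurable_funM|].
by apply: filterS pq; [exact: (ae_filter_ringOfSetsType mu)|move=> t ->].
Qed.

End pairing.

(** * Equality of the two resolutions *)

Theorem proposition8 (R : realType) (f F : R -> R[i]) (lambda : R[i])
  (hf : in_L2 f)
  (hf0 : ~ {ae @lebesgue_measure R, forall t, f t = 0})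
  (hF : is_fourier_transform f F)
  (hinv : {ae @lebesgue_measure R, forall w, F w = lambda * f w}) :
  time_resolution f = freq_resolution f F.
Proof.
have L := fourier_eigenvalue_norm f F lambda hf hf0 hF hinv.
have [_ hF2 _] := hF.
have mnorm g : in_L2 g -> measurable_fun setT (fun t => Normc.normc (g t) ^+ 2).
  move=> /in_L2_square_integrable[[mr _] [mi _]].
  under eq_fun do rewrite normc_sqr.
  by apply: measurable_funD; exact: measurable_funX.
apply: std_dev_ae_eq.
- by apply: measurable_funM => //; exact: mnorm.
- by apply: measurable_funM => //; exact: mnorm.
- apply: filterS hinv.
    exact: (ae_filter_ringOfSetsType (@lebesgue_measure R)).
  (* The factor [2 * pi] from [|lambda|^2] cancels the normalisation of the frequency density. *)
  move=> t Ft; rewrite /time_density /freq_density Ft Normc.normcM exprMn L.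
  have pi0 : 2 * pi != 0 :> R by rewrite mulf_neq0// gt_eqF// pi_gt0.
  by rewrite invfM mulrACA mulfV// mul1r.
Qed.
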